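(* Let $\mathcal{H}$ be a finite-dimensional Hilbert space, let $C\subseteq\mathcal{H}$ be a closed convex cone, and let $A:\mathcal{H}\to\mathbb{R}^m$ be linear. If $C\cap\ker A=\{0\}$, then there exists a $\theta>0$ such that $C^{\wedge\theta}\cap\ker A=\{0\}$.
   Context: A convex cone is a convex set $C$ with $\tau C=C$ for all $\tau>0$. With $\langle\cdot,\cdot\rangle$ and $\|\cdot\|$ the inner product and induced norm of $\mathcal{H}$, for $\theta\in[0,\pi]$ the $\theta$-expansion of $C$ is $C^{\wedge\theta}=\{0\}\cup\{x\in\mathcal{H} : \exists y\in C\setminus\{0\},\ \langle x,y\rangle\ge\cos(\theta)\|x\|\|y\|\}$. ''$\theta>0$'' means $\theta\in(0,\pi]$. *)

(* Defs.v *)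
From HB Require Import structures.
From mathcomp Require Import all_boot all_order all_algebra sesquilinear.
From mathcomp Require Import all_classical all_reals all_analysis.

Set Implicit Arguments.
Unset Strict Implicit.
Unset Printing Implicit Defensive.

Import Order.TTheory GRing.Theory Num.Theory.
Import numFieldNormedType.Exports.

Local Open Scope classical_set_scope.
Local Open Scope ring_scope.

HB.mixin Record NormedModule_hasInner (R : realType) H
    of NormedModule R H := {
  inner : {dot H for idfun};
  norm_inner : forall x : H, `|x| = Num.sqrt (inner x x)
}.

(* Completeness is not a field: it is automatic in finite dimension. *)
#[short(type="finHilbertType")]
HB.structure Definition FinHilbert (R : realType) :=
  {H of NormedModule R H & Vector R H & NormedModule_hasInner R H}.

Definition convex_cone (R : numDomainType) (V : lmodType R) (C : set V) : Prop :=
  convex_set (C : set (convex_lmodType V)) /\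
  forall t : R, 0 < t -> [set t *: x | x in C] = C.

Definition cone_expansion (R : realType) (H : finHilbertType R)
    (theta : R) (C : set H) : set H :=
  [set 0] `|`
  [set x | exists2 y, (C `\ 0) y & cos theta * `|x| * `|y| <= inner x y].

Definition lin_ker (R : numDomainType) (U V : lmodType R)
    (A : {linear U -> V}) : set U :=
  [set x | A x = 0].

(* Main.v *)
Require Import Defs.
From HB Require Import structures.
From mathcomp Require Import all_boot all_order all_algebra sesquilinear.
From mathcomp Require Import all_classical all_reals all_analysis.
From mathcomp Require Import ring lra.

Set Implicit Arguments.
Unset Strict Implicit.
Unset Printing Implicit Defensive.

Import Order.TTheory GRing.Theory Num.Theory.
Import numFieldNormedType.Exports.
Import VectorInternalTheory.

Local Open Scope classical_set_scope.
Local Open Scope ring_scope.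

(** The angle between a cone and a subspace meeting it only in 0 is bounded
away from 0, by compactness.

The part of [C] on the unit sphere is compact, since the space has finite
dimension, and [A] does not vanish on it; so [|A y| >= e |y|] for all [y] in [C]
and some [e > 0], by homogeneity.  If [M] bounds the operator norm of [A] and [x]
is in the kernel, then [e |y| <= |A y| = |A (x - y)| <= M |x - y|]: with
[d = e / M], every kernel vector is at distance at least [d |y|] from every [y] in
[C] ([cone_kernel_distance]).

On the other hand, let [x != 0] make an angle at most [theta] with some nonzero
[y] in [C].  Rescaling [y] to the length of [x], which keeps it in [C], gives
[|x - y|^2 <= 2 (1 - cos theta) |x|^2] ([small_angle_rescale]).  If [x] is also in
the kernel, the two bounds give [d^2 <= 2 (1 - cos theta)], which fails as soon as
[theta] is small enough ([cos_near1]).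

Compactness and boundedness in [H] are transported from row vectors through the
coordinate isomorphism [r2v]; this is harmless because all norms on row vectors
are equivalent ([linear_rV_bounded] and [injective_linear_rV_expands]). *)

(** A form of the extreme value theorem in which [K] may be empty, for use with
the unit sphere of a space that may be 0, or of a cone that may be [{0}]. *)
Lemma compact_pos_lower_bound (R : realType) (T : topologicalType) (K : set T)
    (f : T -> R) :
  compact K -> continuous f -> (forall x, K x -> 0 < f x) ->
  exists2 c, 0 < c & forall x, K x -> c <= f x.
Proof.
move=> Kc fc fpos.
have [->|K0] := eqVneq K set0; first by exists 1 => // x [].
have [||y yK ymin] := @compact_EVT_min T R f K _ Kc; first exact/set0P.
  exact: continuous_subspaceT.
exists (f y); first by apply/fpos/set_mem.
by move=> x Kx; apply: ymin; rewrite inE.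
Qed.

Lemma closed_unit_sphere (R : realType) (W : normedModType R) :
  closed [set x : W | `|x| = 1].
Proof.
apply: (@preimage_closed W R Num.norm [set 1]); last exact: closed_eq.
by move=> x _; exact: norm_continuous.
Qed.

Lemma linear_rV_bounded (R : realType) (n : nat) (W : normedModType R)
    (f : {linear 'rV[R]_n -> W}) :
  exists2 M, 0 < M & forall v, `|f v| <= M * `|v|.
Proof.
(* The summand 1 only makes the constant positive: the sum is 0 when f is. *)
exists (1 + \sum_i `|f (delta_mx 0 i)|).
  by rewrite ltr_pwDl// sumr_ge0.
move=> v; rewrite {1}(row_sum_delta v) linear_sum.
rewrite (le_trans (ler_norm_sum _ _ _))//.
rewrite mulrDl mul1r mulr_suml ler_wpDl// ler_sum// => i _.
rewrite linearZ/= normrZ mulrC ler_wpM2l//.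
by rewrite [leRHS]/Num.norm/= mx_normrE; apply/bigmax_geP; right; exists (0, i).
Qed.

Lemma linear_rV_continuous (R : realType) (n : nat) (W : normedModType R)
    (f : {linear 'rV[R]_n -> W}) : continuous f.
Proof.
have [M M0 fM] := linear_rV_bounded f.
apply: bounded_linear_continuous; apply/bounded_funP => r; exists (M * r) => x xr.
by rewrite (le_trans (fM x))// ler_pM2l.
Qed.

(** The nontrivial half of the equivalence of norms, applied to the norm that
[f] pulls back to row vectors: that norm is continuous and positive on the compact
unit sphere of the sup norm. *)
Lemma injective_linear_rV_expands (R : realType) (n : nat) (W : normedModType R)
    (f : {linear 'rV[R]_n -> W}) :
  injective f -> exists2 c, 0 < c & forall v, c * `|v| <= `|f v|.
Proof.
move=> finj; pose S : set 'rV[R]_n := [set v | `|v| = 1].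
have Scompact : compact S.
  apply: bounded_closed_compact.
    exists 1; split; first exact: num_real.
    by move=> M M1 v /= ->; exact: ltW.
  exact: closed_unit_sphere.
have [||c c0 cS] := @compact_pos_lower_bound R _ S (fun v => `|f v|) Scompact.
- move=> v; apply: continuous_comp; first exact: linear_rV_continuous.
  exact: norm_continuous.
- move=> v Sv; rewrite normr_gt0 -(linear0 f); apply/eqP => /finj v0.
  by move/eqP: Sv; rewrite v0 normr0 eq_sym oner_eq0.
exists c => // v; have [->|v0] := eqVneq v 0; first by rewrite normr0 mulr0.
rewrite -ler_pdivlMr ?normr_gt0//.
have := cS (`|v|^-1 *: v); rewrite linearZ/= !normrZ normfV normr_id mulrC; apply.
by rewrite /S/= normrZ normfV normr_id mulVf ?normr_eq0.
Qed.

Section finite_dimension.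
Variables (R : realType) (H : finHilbertType R).
Implicit Types x y : H.

(** The Heine-Borel property of [H], in the coordinates given by [r2v]: the preimage
of [K] is bounded because [r2v] expands norms by a positive factor at least. *)
Lemma closed_bounded_coord_compact (K : set H) :
  closed K -> bounded_set K -> compact (r2v @^-1` K : set 'rV[R]_(dim H)).
Proof.
move=> Kcl [M [Mreal KM]].
have [c c0 cr2v] := injective_linear_rV_expands (@r2v_inj R H).
apply: bounded_closed_compact.
  exists (c^-1 * M); split; first exact: num_real.
  move=> N MN v Kv /=; rewrite -(ler_pM2l c0) (le_trans (cr2v v))//.
  by apply: KM => //; rewrite -ltr_pdivrMl.
apply: (@preimage_closed 'rV[R]_(dim H) H r2v K) => // v _.
exact: linear_rV_continuous.
Qed.

Lemma linear_fin_bounded (W : normedModType R) (A : {linear H -> W}) :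
  exists2 M, 0 < M & forall x, `|A x| <= M * `|x|.
Proof.
have [c c0 cr2v] := injective_linear_rV_expands (@r2v_inj R H).
have [M M0 AM] := linear_rV_bounded (A \o r2v : {linear 'rV[R]_(dim H) -> W}).
exists (M / c); first exact: divr_gt0.
move=> x; rewrite -{1 2}(v2rK x) (le_trans (AM _))// -mulrA ler_pM2l//.
by rewrite ler_pdivlMl// cr2v.
Qed.

(** On the compact unit sphere of the cone [|A y|] has a positive lower bound [e]; a
kernel vector [x] near [y] would make [A y = - A (x - y)] smaller than that.
Invariance of [C] under scaling extends the bound to the whole cone. *)
Lemma cone_kernel_distance (W : normedModType R) (C : set H)
    (A : {linear H -> W}) :
  closed C -> (forall (t : R) y, 0 < t -> C y -> C (t *: y)) ->
  C `&` lin_ker A `<=` [set 0] ->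
  exists2 d, 0 < d & forall x y, C y -> lin_ker A x -> d * `|y| <= `|x - y|.
Proof.
move=> Ccl Ccone CA.
pose K := C `&` [set y | `|y| = 1].
have Kcompact : compact (r2v @^-1` K : set 'rV[R]_(dim H)).
  apply: closed_bounded_coord_compact.
    apply: closedI => //.
    exact: closed_unit_sphere.
  exists 1; split; first exact: num_real.
  by move=> M M1 v [_ /= ->]; exact: ltW.
pose B : {linear 'rV[R]_(dim H) -> W} := A \o r2v.
have [||e e0 eK] := @compact_pos_lower_bound R _ _
    (fun v : 'rV[R]_(dim H) => `|A (r2v v)|) Kcompact.
- move=> v; apply: (@continuous_comp _ _ _ B Num.norm).
    exact: linear_rV_continuous.
  exact: norm_continuous.
- move=> v [Cv v1]; rewrite normr_gt0; apply/eqP => Av.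
  have /= v0 := CA _ (conj Cv Av).
  by move/eqP: v1; rewrite /= v0 normr0 eq_sym oner_eq0.
have [M M0 AM] := linear_fin_bounded A.
exists (e / M); first exact: divr_gt0.
move=> x y Cy Ax; have [->|y0] := eqVneq y 0.
  by rewrite normr0 mulr0.
have ny : 0 < `|y| by rewrite normr_gt0.
have eA : e * `|y| <= `|A y|.
  have := eK (v2r (`|y|^-1 *: y)); rewrite /= v2rK linearZ/= normrZ normfV.
  rewrite normr_id mulrC ler_pdivlMr//; apply; split.
    by apply: Ccone; rewrite ?invr_gt0.
  by rewrite /= normrZ normfV normr_id mulVf ?normr_eq0.
rewrite mulrAC ler_pdivrMr// (le_trans eA)// mulrC.
by have := AM (x - y); rewrite linearB Ax sub0r normrN.
Qed.

Lemma norm2_inner x : `|x| ^+ 2 = inner x x.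
Proof.
rewrite norm_inner sqr_sqrtr//; have [->|x0] := eqVneq x 0.
  by rewrite linear0l.
by apply/ltW/neq0_dnorm_gt0.
Qed.

Lemma norm2B x y : `|x - y| ^+ 2 = `|x| ^+ 2 + `|y| ^+ 2 - 2 * inner x y.
Proof.
by rewrite !norm2_inner hnormB/= expr0 mul1r -mulr2n mulr_natl.
Qed.

(** Once [y] has the length of [x], the inequality on the angle becomes the upper
bound of the law of cosines for [|x - y|]. *)
Lemma small_angle_rescale (c : R) x y :
  x != 0 -> y != 0 -> c * `|x| * `|y| <= inner x y ->
  exists t : R, [/\ 0 < t, `|t *: y| = `|x|
    & `|x - t *: y| ^+ 2 <= 2 * (1 - c) * `|x| ^+ 2].
Proof.
rewrite -!normr_gt0 => nx ny xy; exists (`|x| / `|y|).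
have t0 : 0 < `|x| / `|y| by exact: divr_gt0.
have nty : `|(`|x| / `|y|) *: y| = `|x|.
  by rewrite normrZ gtr0_norm// divfK// gt_eqF.
split=> //; have : c * `|x| ^+ 2 <= inner x ((`|x| / `|y|) *: y).
  rewrite linearZ/= mulrAC ler_pdivlMr//.
  have -> : c * `|x| ^+ 2 * `|y| = `|x| * (c * `|x| * `|y|) by ring.
  by rewrite ler_pM2l.
by rewrite norm2B nty; lra.
Qed.

End finite_dimension.

Lemma cos_near1 (R : realType) (e : R) :
  0 < e -> exists2 theta : R, 0 < theta <= pi & 2 * (1 - cos theta) < e.
Proof.
(* The value c = 2 / (2 + e) lies in (0, 1) for every e > 0, however large, and
   2 (1 - c) = 2 e / (2 + e) < e. *)
move=> e0; pose c := 2 / (2 + e).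
have e2 : 0 < 2 + e by rewrite addr_gt0.
have c0 : 0 < c by exact: divr_gt0.
have c1 : c < 1 by rewrite ltr_pdivrMr// mul1r ltrDl.
exists (acos c); first by rewrite acos_gt0 ?acos_lepi//; lra.
rewrite acosK; last by rewrite in_itv/=; lra.
have -> : 2 * (1 - c) = 2 * e / (2 + e) by rewrite /c; field; lra.
by rewrite ltr_pdivrMr//; nra.
Qed.

Theorem theorem13 (R : realType) (H : finHilbertType R) (C : set H)
    (m : nat) (A : {linear H -> 'rV[R]_m}) :
  closed C -> convex_cone C ->
  C `&` lin_ker A = [set 0] ->
  exists theta : R,
    0 < theta <= pi /\ cone_expansion theta C `&` lin_ker A = [set 0].
Proof.
move=> Ccl [_ Cscale] CA.
have Ccone (t : R) y : 0 < t -> C y -> C (t *: y).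
  by move=> t0 Cy; rewrite -(Cscale t t0); exists y.
have [|d d0 dC] := cone_kernel_distance Ccl Ccone (A := A); first by rewrite CA.
have [theta theta_itv cos_lt] := cos_near1 (exprn_gt0 2 d0).
exists theta; split=> //.
apply/seteqP; split=> [x [[//|[y [Cy /eqP y0] xy]] Ax]|x /= ->]; last first.
  by split; [left | rewrite /lin_ker/= linear0].
apply/eqP/negPn/negP => x0.
have [t [t0 nty near_ty]] := small_angle_rescale x0 y0 xy.
have := dC _ _ (Ccone _ _ t0 Cy) Ax; rewrite nty => dx.
have {}dx : (d * `|x|) ^+ 2 <= `|x - t *: y| ^+ 2.
  by rewrite ler_sqr ?nnegrE ?mulr_ge0 ?normr_ge0 ?(ltW d0).
have := le_trans dx near_ty.
by rewrite exprMn ler_pM2r ?exprn_gt0 ?normr_gt0// leNgt cos_lt.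
Qed.
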